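(* Let $\Gamma$ be a connected graph with infinite set of vertices $\mathcal{V}$ and path metric $d$ on $\mathcal{V}$; write $B(v,r)=\{u\in\mathcal{V}:d(v,u)\le r\}$. Assume that there exists $r\in\mathbb{N}$ such that $|B(v,r)|=|\mathcal{V}|$ for each $v\in\mathcal{V}$. Then the coarse structure $\mathcal{E}_{\Gamma}$ is $\vee$-decomposable.
   Context: A coarse structure on a set $X$ is a family $\mathcal{E}$ of subsets of $X\times X$ such that: each $\varepsilon\in\mathcal{E}$ contains the diagonal $\Delta_X=\{(x,x):x\in X\}$; if $\varepsilon,\delta\in\mathcal{E}$ then $\varepsilon\circ\delta=\{(x,y):\exists z\,((x,z)\in\varepsilon,(z,y)\in\delta)\}\in\mathcal{E}$ and $\varepsilon^{-1}=\{(y,x):(x,y)\in\varepsilon\}\in\mathcal{E}$; if $\varepsilon\in\mathcal{E}$ and $\Delta_X\subseteq\varepsilon'\subseteq\varepsilon$ then $\varepsilon'\in\mathcal{E}$. Only connected coarse structures on infinite sets are considered: for any $x,y\in X$ there is $\varepsilon\in\mathcal{E}$ with $(x,y)\in\varepsilon$. A subset $\mathcal{E}'\subseteq\mathcal{E}$ is a base of $\mathcal{E}$ if every $\varepsilon\in\mathcal{E}$ is contained in some $\varepsilon'\in\mathcal{E}'$. $\mathcal{E}_0\vee\mathcal{E}_1$ is the smallest (by inclusion) coarse structure on $X$ containing both $\mathcal{E}_0$ and $\mathcal{E}_1$. A coarse structure is cellular if it has a base consisting of equivalence relations. A coarse structure $\mathcal{E}$ on $X$ is $\vee$-decomposable if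 there exist two cellular coarse structures $\mathcal{E}_0,\mathcal{E}_1$ on $X$ with $\mathcal{E}=\mathcal{E}_0\vee\mathcal{E}_1$. For a metric $d$ on $X$, $\mathcal{E}_d$ is the coarse structure with base $\{(x,y)\in X\times X:d(x,y)\le n\}$, $n\in\omega$. For a connected graph $\Gamma$ with vertex set $\mathcal{V}$ and path metric $d$ on $\mathcal{V}$, $\mathcal{E}_\Gamma$ denotes the coarse structure $\mathcal{E}_d$ on $\mathcal{V}$. *)

(* Defs.v *)
From mathcomp Require Import all_boot all_order.
From mathcomp Require Import all_classical.

Set Implicit Arguments.
Unset Strict Implicit.
Unset Printing Implicit Defensive.

Local Open Scope classical_set_scope.
Local Open Scope relation_scope.

(* [del \; eps] is the set of (x, y) with eps (x, z) and del (z, y) for some z. *)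
Record coarse_structure (X : Type) (E : set (set (X * X))) : Prop :=
  CoarseStructure {
    coarse_diag : forall eps, E eps -> diagonal `<=` eps ;
    coarse_comp : forall eps del, E eps -> E del -> E (del \; eps) ;
    coarse_inv : forall eps, E eps -> E eps^-1 ;
    coarse_sub : forall eps eps', E eps ->
      diagonal `<=` eps' -> eps' `<=` eps -> E eps' }.

Definition coarse_connected (X : Type) (E : set (set (X * X))) : Prop :=
  forall x y : X, exists2 eps, E eps & eps (x, y).

Definition coarse_base (X : Type) (E B : set (set (X * X))) : Prop :=
  B `<=` E /\ forall eps, E eps -> exists2 eps', B eps' & eps `<=` eps'.

Definition coarse_join (X : Type) (E0 E1 : set (set (X * X))) :
    set (set (X * X)) :=
  smallest (@coarse_structure X) (E0 `|` E1).

Definition cellular (X : Type) (E : set (set (X * X))) : Prop :=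
  exists2 B, coarse_base E B &
    forall eps, B eps ->
      RelationClasses.Equivalence (fun x y : X => eps (x, y)).

(* By convention all coarse structures under consideration are connected, so
   this is required of both pieces of a decomposition. *)
Definition vee_decomposable (X : Type) (E : set (set (X * X))) : Prop :=
  exists E0 E1 : set (set (X * X)),
    [/\ coarse_structure E0, coarse_connected E0 & cellular E0] /\
    [/\ coarse_structure E1, coarse_connected E1 & cellular E1] /\
    E = coarse_join E0 E1.

(* Stated for nat-valued metrics, which covers path metrics of graphs. *)
Definition metric_coarse (X : Type) (d : X -> X -> nat) : set (set (X * X)) :=
  [set eps | diagonal `<=` eps /\
     exists n : nat, eps `<=` [set xy | d xy.1 xy.2 <= n]].

Definition walk_length (V : Type) (e : rel V) (x y : V) : set nat :=
  [set n | exists p : seq V, [/\ path e x p, last x p = y & size p = n]].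

Definition graph_connected (V : Type) (e : rel V) : Prop :=
  forall x y : V, exists n : nat, walk_length e x y n.

(* The default value 0 is taken only when no walk joins x to y, which does not
   happen in a connected graph. *)
Definition path_metric (V : Type) (e : rel V) (x y : V) : nat :=
  xget 0 [set n | walk_length e x y n /\
                  forall m, walk_length e x y m -> n <= m].

Definition graph_ball (V : Type) (e : rel V) (v : V) (r : nat) : set V :=
  [set u | path_metric e v u <= r].

Definition graph_coarse (V : Type) (e : rel V) : set (set (V * V)) :=
  metric_coarse (path_metric e).

(* Main.v *)
Require Import Defs.
From mathcomp Require Import all_boot all_order.
From mathcomp Require Import all_classical.
From mathcomp Require Import zify.

(** Choose a maximal set S of vertices whose balls B(s,r) are pairwise disjoint,
    and partition the vertices into bounded cells, one around each s in S and
    containing B(s,r). Since B(s,r) is as large as the whole vertex set, there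
    is an injection phi_s of the vertices into B(s,r). The involution
    phi_s(t) <-> phi_t(s), for s, t in S at bounded distance, is a second
    bounded partition: it plants a private edge between any two nearby cells.
    Adjacent vertices are then joined by cell-step, involution-step, cell-step,
    so the two partitions generate the coarse structure. To make each of the two
    cellular pieces connected, all the classes meeting a ball around a fixed
    base point are merged, for balls of all radii. *)

Set Implicit Arguments.
Unset Strict Implicit.
Unset Printing Implicit Defensive.

Local Open Scope classical_set_scope.
Local Open Scope card_scope.
Local Open Scope relation_scope.

Lemma card_leT_inj (T U : Type) (B : set U) : [set: T] #<= B ->
  exists2 f : T -> U, injective f & forall x, B (f x).
Proof.
move=> /card_leP[f].
exists (fun x => val (f (SigSub (mem_set (I : [set: T] x))))) => [x y|x].
  by move=> /val_inj /(inj (f := f)) - /(_ (in_setT _) (in_setT _)) /(congr1 val).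
exact: set_valP.
Qed.

(** * Coarse structures exhausted by a sequence of relations *)

Section CoarseStructures.
Variable X : Type.
Implicit Types (P eps : set (X * X)) (E : set (set (X * X))).

Lemma coarse_refl E eps (x : X) : coarse_structure E -> E eps -> eps (x, x).
Proof. by move=> Ecoarse Eeps; apply: (coarse_diag Ecoarse Eeps). Qed.

(** For [Q n] the relation [d x y <= n] this unfolds to [metric_coarse d], so the metric structure
    and the merged ones share their closure proofs. *)
Definition exhausted_coarse (Q : nat -> set (X * X)) : set (set (X * X)) :=
  [set eps | diagonal `<=` eps /\ exists n, eps `<=` Q n].

Lemma exhausted_coarse_structure (Q : nat -> set (X * X)) :
    (forall n x y, Q n (x, y) -> Q n (y, x)) ->
    (forall m n, exists k, Q m \; Q n `<=` Q k) ->
  coarse_structure (exhausted_coarse Q).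
Proof.
move=> Qsym Qcomp; split.
- by move=> eps [].
- move=> eps del [eps1 [m epsm]] [del1 [n deln]]; split.
    by move=> [x y] /= xy; exists y; [exact: eps1|exact: del1].
  have [k Qk] := Qcomp n m; exists k => -[x y] /= [z xz zy].
  by apply: Qk; exists z; [exact: epsm|exact: deln].
- move=> eps [eps1 [n epsn]]; split; first by move=> [x y] /= xy; exact: eps1.
  by exists n => -[x y] /= /epsn /Qsym.
- move=> eps eps' [_ [n epsn]] diag' sub'; split=> //.
  by exists n; exact: subset_trans epsn.
Qed.

Lemma exhausted_cellular (Q : nat -> set (X * X)) :
    (forall n, RelationClasses.Equivalence (fun x y => Q n (x, y))) ->
  cellular (exhausted_coarse Q).
Proof.
move=> Qequiv; have diagQ n : diagonal `<=` Q n.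
  by move=> [x y] /diagonalP ->; have [r _ _] := Qequiv n; exact: r.
exists (range Q).
  split; first by move=> _ [n _ <-]; split; [exact: diagQ|exists n].
  by move=> eps [_ [n epsn]]; exists (Q n) => //; exists n.
by move=> _ [n _ <-]; exact: Qequiv.
Qed.

Lemma exhausted_equiv_coarse (Q : nat -> set (X * X)) :
    (forall n, RelationClasses.Equivalence (fun x y => Q n (x, y))) ->
    (forall m n, m <= n -> Q m `<=` Q n) ->
  coarse_structure (exhausted_coarse Q).
Proof.
move=> Qequiv Qmono; apply: exhausted_coarse_structure.
  by move=> n x y; have [_ s _] := Qequiv n; exact: s.
move=> m n; exists (maxn m n) => -[x y] /= [z xz zy].
have [_ _ t] := Qequiv (maxn m n); apply: (t x z y).
  by apply: Qmono xz; exact: leq_maxr.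
by apply: Qmono zy; exact: leq_maxl.
Qed.

(** * Bounded equivalence relations and connectedness by merging *)

Section Metric.
Variable d : X -> X -> nat.
Hypothesis dC : forall x y, d x y = d y x.
Hypothesis dtri : forall x y z, d x z <= d x y + d y z.

Lemma metric_coarse_structure : coarse_structure (metric_coarse d).
Proof.
apply: (@exhausted_coarse_structure (fun n => [set xy | d xy.1 xy.2 <= n])).
  by move=> n x y /=; rewrite dC.
move=> m n; exists (n + m) => -[x y] /= [z xz zy].
by apply: leq_trans (dtri x z y) _; exact: leq_add.
Qed.

Definition merge_ball (o : X) (P : set (X * X)) (n : nat) : set (X * X) :=
  let sat := [set x | exists2 a, d o a <= n & P (a, x)] in P `|` sat `*` sat.

Section MergeBall.
Variables (o : X) (P : set (X * X)) (D : nat).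
Hypothesis Pequiv : RelationClasses.Equivalence (fun x y => P (x, y)).
Hypothesis PD : P `<=` [set xy | d xy.1 xy.2 <= D].

Lemma merge_ball_equiv n :
  RelationClasses.Equivalence (fun x y => merge_ball o P n (x, y)).
Proof.
have [r s t] := Pequiv; split.
- by move=> x; left; exact: r.
- by move=> x y [/s|[]]; [left|right].
(* The merged set is a union of [P]-classes, so a [P]-step never leaves it; this settles the two
   mixed cases. *)
- move=> x y z [xy|[[a oa ax] [b ob yb]]] [yz|[[a' oa' ya'] [b' ob' zb']]] /=.
  + by left; exact: t yz.
  + right; split; [exists a' => //=|by exists b'].
    by apply: t ya' _; exact: s.
  + by right; split; [exists a|exists b => //=; exact: t yz].
  + by right; split; [exists a|exists b'].
Qed.

Lemma merge_ball_mono m n : m <= n -> merge_ball o P m `<=` merge_ball o P n.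
Proof.
move=> mn [x y] [xy|[[a oa ax] [b ob yb]]]; first by left.
by right; split; [exists a|exists b] => //; exact: leq_trans mn.
Qed.

Lemma merge_ball_coarse :
  [/\ coarse_structure (exhausted_coarse (merge_ball o P)),
      coarse_connected (exhausted_coarse (merge_ball o P)) &
      cellular (exhausted_coarse (merge_ball o P))].
Proof.
have Qe := merge_ball_equiv; split.
- by apply: exhausted_equiv_coarse => // m n; exact: merge_ball_mono.
- move=> x y; exists (merge_ball o P (maxn (d o x) (d o y))).
    split; last by exists (maxn (d o x) (d o y)).
    by move=> [u v] /diagonalP ->; have [r _ _] := Qe (maxn (d o x) (d o y)); exact: r.
  have [r _ _] := Pequiv; right; split=> /=.
    by exists x; [exact: leq_maxl|exact: r].
  by exists y; [exact: leq_maxr|exact: r].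
- exact: exhausted_cellular.
Qed.

Lemma merge_ball_sub_metric :
  exhausted_coarse (merge_ball o P) `<=` metric_coarse d.
Proof.
(* Two merged points [x], [y] are linked through [x], [a], [o], [b], [y], with steps of length at
   most [D], [n], [n], [D]. *)
move=> eps [eps1 [n epsn]]; split=> //; exists (D + (n + n + D)).
apply: subset_trans epsn _ => -[x y] [/PD /= xy|[[a oa /PD /= ax] [b ob /PD /= yb]]].
  exact: leq_trans (leq_addr _ _).
have := dtri x a y; have := dtri a o y; have := dtri o b y.
by rewrite (dC x a) (dC a o); lia.
Qed.

Lemma merge_ball_mem : exhausted_coarse (merge_ball o P) P.
Proof.
have [r _ _] := Pequiv; split; first by move=> [x y] /diagonalP ->; exact: r.
by exists 0 => xy; left.
Qed.

End MergeBall.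

(** Merging makes both pieces connected without changing the join: the merged relations stay
    bounded, so the join remains inside the metric structure, and they contain [P0] and [P1], which
    already generate it. *)
Lemma vee_decomposable_metric (o : X) (P0 P1 : set (X * X)) (D0 D1 : nat) :
    RelationClasses.Equivalence (fun x y => P0 (x, y)) ->
    RelationClasses.Equivalence (fun x y => P1 (x, y)) ->
    P0 `<=` [set xy | d xy.1 xy.2 <= D0] ->
    P1 `<=` [set xy | d xy.1 xy.2 <= D1] ->
    (forall G, coarse_structure G -> G P0 -> G P1 ->
      forall n, exists2 eps, G eps & [set xy | d xy.1 xy.2 <= n] `<=` eps) ->
  vee_decomposable (metric_coarse d).
Proof.
move=> eq0 eq1 PD0 PD1 gen.
exists (exhausted_coarse (merge_ball o P0)), (exhausted_coarse (merge_ball o P1)).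
split; first exact: merge_ball_coarse.
split; first exact: merge_ball_coarse.
apply/seteqP; split.
  move=> eps [eps1 [n epsn]] G [Gcoarse subG].
  have [||del Gdel ndel] := gen G Gcoarse _ _ n.
  - by apply: subG; left; exact: merge_ball_mem.
  - by apply: subG; right; exact: merge_ball_mem.
  - by apply: (coarse_sub Gcoarse Gdel) => //; exact: subset_trans ndel.
apply: smallest_sub; first exact: metric_coarse_structure.
move=> eps [].
  exact: (merge_ball_sub_metric PD0).
exact: (merge_ball_sub_metric PD1).
Qed.

End Metric.
End CoarseStructures.

(** * The path metric of a connected graph *)

Section PathMetric.
Variables (V : Type) (e : rel V).
Hypotheses (e_sym : symmetric e) (e_conn : graph_connected e).

Lemma path_metricP x y : walk_length e x y (path_metric e x y) /\
  forall m, walk_length e x y m -> path_metric e x y <= m.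
Proof.
(* Connectedness supplies a shortest walk, so the default value 0 of [xget] is not taken. *)
apply: (xgetPex 0 (P := [set n | walk_length e x y n /\
                  forall m, walk_length e x y m -> n <= m])).
have ex_walk : exists n, `[< walk_length e x y n >].
  by have [n xyn] := e_conn x y; exists n; exact/asboolP.
case: (ex_minnP ex_walk) => n /asboolP xyn nmin.
by exists n; split=> // m xym; apply: nmin; exact/asboolP.
Qed.

Lemma walk_length_sym x y n : walk_length e x y n -> walk_length e y x n.
Proof.
move=> [p [xp <- <-]]; exists (rev (belast x p)); split.
- by rewrite rev_path (eq_path (e' := e)) // => u v; exact: e_sym.
- by case: p {xp} => //= a p; rewrite rev_cons last_rcons.
- by rewrite size_rev size_belast.
Qed.

Lemma path_metric_xx x : path_metric e x x = 0.
Proof.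
by apply/eqP; rewrite -leqn0; apply: (path_metricP x x).2; exists [::].
Qed.

Lemma path_metric_sym x y : path_metric e x y = path_metric e y x.
Proof.
by apply/eqP; rewrite eqn_leq; apply/andP; split;
  apply: (path_metricP _ _).2; apply: walk_length_sym;
  exact: (path_metricP _ _).1.
Qed.

Lemma path_metric_triangle x y z :
  path_metric e x z <= path_metric e x y + path_metric e y z.
Proof.
have [[p [xp py <-]] _] := path_metricP x y.
have [[q [yq qz <-]] _] := path_metricP y z.
apply: (path_metricP x z).2; exists (p ++ q).
by rewrite cat_path last_cat size_cat py xp yq.
Qed.

Lemma path_metric_edge x y : e x y -> path_metric e x y <= 1.
Proof. by move=> xy; apply: (path_metricP x y).2; exists [:: y] => /=; rewrite xy. Qed.

(** A walk of length at most [n] is absorbed by an iterated composite of [R]; since entourages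
    contain the diagonal, shorter walks are covered too. *)
Lemma path_metric_generated (G : set (set (V * V))) (R : set (V * V)) :
    coarse_structure G -> G R -> (forall x y, e x y -> R (x, y)) ->
  forall n, exists2 eps, G eps & [set xy | path_metric e xy.1 xy.2 <= n] `<=` eps.
Proof.
move=> Gcoarse GR eR n.
suff [eps Geps walks] : exists2 eps, G eps &
    forall x p, path e x p -> size p <= n -> eps (x, last x p).
  exists eps => // -[x y] /=.
  have [[p [xp yE <-]] _] := path_metricP x y.
  by rewrite -yE; exact: walks.
elim: n => [|n [eps Geps walks]].
  by exists R => // x [|a p] _ // _; exact: (coarse_refl _ Gcoarse GR).
exists (eps \; R); first exact: (coarse_comp Gcoarse).
move=> x [_ _|y p /= /andP[xy yp] pn] /=.
  by exists x; [exact: (coarse_refl _ Gcoarse GR)|exact: (coarse_refl _ Gcoarse Geps)].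
by exists y; [exact: eR|exact: walks].
Qed.

End PathMetric.

(** [c x] is the centre of the cell of [x]. A point in some ball of the disjoint family goes to the
    centre of that ball, unique by disjointness; any other point goes to a centre whose ball meets
    its own, which exists by maximality. *)
Lemma ex_cells (X : Type) (d : X -> X -> nat) (r : nat) :
    (forall x, d x x = 0) -> (forall x y, d x y = d y x) ->
    (forall x y z, d x z <= d x y + d y z) ->
  exists c : X -> X, [/\ forall x, d (c x) x <= r + r
    & forall x y, d (c x) y <= r -> c y = c x].
Proof.
move=> dxx dC dtri; pose B x := [set y | d x y <= r].
have [S [_ trivS maxS]] := ex_maximal_disjoint_subcollection B [set: X].
have sepS s t x : S s -> S t -> B s x -> B t x -> s = t.
  by move=> Ss St sx tx; apply: trivS => //; exists x.
have coverS x : exists2 s, S s & B s `&` B x !=set0.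
  apply: contrapT => nS; have Sx : ~ S x.
    by move=> Sx; apply: nS; exists x => //; exists x; split; rewrite /B /= dxx.
  (* If [B x] missed every ball of the family, [x] could be added to [S]. *)
  apply: (maxS (x |` S)) => //.
    by split=> [|sub]; [exact: subsetUr|apply: Sx; apply: sub; left].
  move=> s t [->|Ss] [->|St] // ne.
  - by exfalso; apply: nS; exists t => //; rewrite setIC.
  - by exfalso; apply: nS; exists s.
  - exact: trivS.
have ex_c x : exists s, [/\ S s, d s x <= r + r &
    forall t, S t -> B t x -> t = s].
  have [[s Ss sx]|nS] := pselect (exists2 s, S s & B s x).
    exists s; split=> //; first by exact: leq_trans (leq_addr _ _).
    by move=> t St tx; exact: sepS tx sx.
  have [s Ss [y [sy xy]]] := coverS x; exists s; split=> //.
    by have := dtri s y x; move: sy xy; rewrite /B /= (dC y); lia.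
  by move=> t St tx; exfalso; apply: nS; exists t.
have [c cP] := choice ex_c; exists c; split=> [x|x y xy].
  by have [] := cP x.
by have [Scx _ _] := cP x; have [_ _ /(_ _ Scx xy)] := cP y.
Qed.

Theorem proposition11 (V : Type) (e : rel V)
    (e_sym : symmetric e) (e_irr : irreflexive e)
    (e_conn : graph_connected e)
    (V_inf : infinite_set [set: V])
    (balls : exists r : nat, forall v : V, graph_ball e v r #= [set: V]) :
  vee_decomposable (graph_coarse e).
Proof.
have [o _] := infinite_setN0 V_inf.
have [r ball_r] := balls.
pose d := path_metric e.
have dxx : forall x, d x x = 0 by exact: path_metric_xx.
have dC : forall x y, d x y = d y x by exact: path_metric_sym.
have dtri : forall x y z, d x z <= d x y + d y z by exact: path_metric_triangle.
have [c [c_near c_ball]] := @ex_cells V d r dxx dC dtri.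
have ex_phi s : exists f : V -> V, injective f /\ forall x, d s (f x) <= r.
  have [_ le] := (card_eqPle _ _).1 (ball_r s).
  by have [f finj fball] := card_leT_inj le; exists f.
have [phi phiP] := choice ex_phi.
have phi_inj s : injective (phi s) by case: (phiP s).
have phi_near s x : d s (phi s x) <= r by case: (phiP s) => _; apply.
have c_phi x y : c (phi (c x) y) = c x by exact: c_ball.
pose P0 : set (V * V) := [set xy | c xy.1 = c xy.2].
(* [D] bounds the distance between the centres of the cells of two adjacent vertices: centre to
   vertex, edge, vertex to centre. *)
pose D := r + r + 1 + (r + r).
pose P1 : set (V * V) := [set xy | xy.1 = xy.2 \/ exists x y,
  [/\ d (c x) (c y) <= D, xy.1 = phi (c x) (c y) & xy.2 = phi (c y) (c x)]].
have eq0 : RelationClasses.Equivalence (fun x y => P0 (x, y)).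
  by split=> // x y z; rewrite /P0 /= => -> ->.
have eq1 : RelationClasses.Equivalence (fun x y => P1 (x, y)).
  split=> [x|x y [/= ->|[a [b [ab /= -> ->]]]]|]; [by left|by left| |].
    by right; exists b, a; rewrite dC.
  move=> x y z [/= -> //|[a [b [ab /= -> ->]]]] [/= <-|].
    by right; exists a, b.
  (* Two matched pairs sharing the middle point coincide: applying [c] to that point recovers its
     own centre, and injectivity of [phi] recovers the other one. The second step thus returns to
     the start. *)
  move=> [a' [b' [_ /= eab ->]]]; left.
  have ca' : c b = c a' by rewrite -(c_phi b (c a)) eab c_phi.
  by move: eab; rewrite -ca' => /phi_inj ->.
apply: (@vee_decomposable_metric V d dC dtri o P0 P1
          (r + r + (r + r)) (r + D + r)) => //.
- move=> [x y]; rewrite /P0 /= => cxy.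
  have := dtri x (c x) y; have := c_near x; have := c_near y.
  by rewrite cxy (dC x (c y)); lia.
- move=> [x y] [/= ->|[a [b [ab /= -> ->]]]]; first by rewrite dxx.
  have := dtri (phi (c a) (c b)) (c a) (phi (c b) (c a)).
  have := dtri (c a) (c b) (phi (c b) (c a)).
  have := phi_near (c a) (c b); have := phi_near (c b) (c a).
  by rewrite (dC (phi _ _) (c a)); lia.
move=> G Gcoarse GP0 GP1.
apply: (@path_metric_generated V e e_conn G ((P0 \; P1) \; P0)) => //.
  by apply: (coarse_comp Gcoarse GP0); exact: (coarse_comp Gcoarse).
(* The matched points lie in the balls of [c x] and [c y], hence in the cells of [x] and [y]. *)
move=> x y xy; exists (phi (c x) (c y)); first by rewrite /P0 /= c_phi.
exists (phi (c y) (c x)); last by rewrite /P0 /= c_phi.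
right; exists x, y; split=> //.
have := dtri (c x) x (c y); have := dtri x y (c y).
have := c_near x; have := c_near y; have := path_metric_edge e_conn xy.
by rewrite -/(d x y) (dC y (c y)) /D; lia.
Qed.
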